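(* Let $f(x)=x^TAx+2a^Tx+a_0$ and $g(x)=x^TBx+2b^Tx+b_0$ be quadratic functions on $\mathbb{R}^n$, where $A,B$ are real symmetric $n\times n$ matrices, $a,b\in\mathbb{R}^n$, $a_0,b_0\in\mathbb{R}$. Then $$\{f=0\}\cap\{g=0\}=\emptyset$$ holds if and only if exactly one of the following three mutually exclusive statements holds. (C1) There exists $(\lambda,\mu)\neq(0,0)$ in $\mathbb{R}^2$ such that $\lambda f(x)+\mu g(x)>0$ for all $x\in\mathbb{R}^n$. (C2) Both of the following hold: (a) there exists $(\lambda,\mu)\neq(0,0)$ in $\mathbb{R}^2$, unique up to multiplication by a positive constant, such that $\lambda f(x)+\mu g(x)\ge 0$ for all $x\in\mathbb{R}^n$; moreover $\lambda f+\mu g$ attains its minimal value $0$; (b) on the minimum solution set $\mathcal W=\{\lambda f+\mu g=0\}=\{\lambda\nabla f+\mu\nabla g=0\}$ of $\lambda f+\mu g$, either $\mu f-\lambda g>0$ everywhere on $\mathcal W$, or $\mu f-\lambda g<0$ everywhere on $\mathcal W$. (C3) $f$ and $g$ have the separation property.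
   Context: For a function $h:\mathbb{R}^n\to\mathbb{R}$ and $\star\in\{<,\le,=\}$, $\{h\star 0\}$ denotes $\{x\in\mathbb{R}^n\mid h(x)\star 0\}$; similarly $\{\nabla h=0\}=\{x\mid \nabla h(x)=0\}$. Quadratic functions may have zero quadratic part (affine functions are allowed). Separation: $\{g=0\}$ is said to separate $\{f\star 0\}$, $\star\in\{<,\le,=\}$, if there are non-empty subsets $L^-,L^+$ of $\{f\star 0\}$ with $L^-\cup L^+=\{f\star 0\}$ and $g(u)<0<g(v)$ for all $u\in L^-$, $v\in L^+$. Separation property: $f$ and $g$ have the separation property if $\{f=0\}$ separates $\{g=0\}$, or $\{g=0\}$ separates $\{f=0\}$ (possibly both). *)

(* Defs.v *)
From mathcomp Require Export all_boot all_order all_algebra.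
From mathcomp Require Export boolp classical_sets reals topology normedtype derive.
Export GRing.Theory Num.Theory numFieldNormedType.Exports.

Set Implicit Arguments.
Unset Strict Implicit.
Unset Printing Implicit Defensive.

Local Open Scope ring_scope.
Local Open Scope classical_set_scope.

Definition quadratic (R : realType) (n : nat)
    (A : 'M[R]_n) (a : 'cV[R]_n) (a0 : R) (x : 'cV[R]_n) : R :=
  (x^T *m A *m x) 0 0 + 2 * (a^T *m x) 0 0 + a0.

Definition zero_set (R : realType) (n : nat) (h : 'cV[R]_n -> R) :
  set 'cV[R]_n := [set x | h x = 0].

Definition gradient (R : realType) (n : nat) (h : 'cV[R]_n -> R)
    (x : 'cV[R]_n) : 'cV[R]_n :=
  \col_i 'D_(delta_mx i 0) h x.

Definition argmin_set (R : realType) (n : nat) (h : 'cV[R]_n -> R) :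
  set 'cV[R]_n := [set x | forall y, h x <= h y].

(* The zero set of [g] separates the set [S]; [S] is meant to be a sublevel or
   level set of another function. *)
Definition separates (R : realType) (n : nat) (g : 'cV[R]_n -> R)
    (S : set 'cV[R]_n) : Prop :=
  exists Lm Lp : set 'cV[R]_n,
    [/\ Lm !=set0, Lp !=set0, Lm `|` Lp = S
      & forall u v, Lm u -> Lp v -> g u < 0 /\ 0 < g v].

Definition separation_property (R : realType) (n : nat)
    (f g : 'cV[R]_n -> R) : Prop :=
  separates f (zero_set g) \/ separates g (zero_set f).

Definition positive_pencil (R : realType) (n : nat)
    (f g : 'cV[R]_n -> R) : Prop :=
  exists lambda mu : R, (lambda, mu) <> (0, 0) /\
    forall x, 0 < lambda * f x + mu * g x.

(* The two descriptions of the set of minimizers in the second component are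
   redundant: they follow from the first component when [f] and [g] are
   quadratic. *)
Definition tangent_pencil (R : realType) (n : nat)
    (f g : 'cV[R]_n -> R) : Prop :=
  exists lambda mu : R,
    let h := fun x => lambda * f x + mu * g x in
    let W := argmin_set h in
    [/\ (lambda, mu) <> (0, 0),
        forall x, 0 <= h x,
        forall lambda' mu' : R, (lambda', mu') <> (0, 0) ->
          (forall x, 0 <= lambda' * f x + mu' * g x) ->
          exists c : R, [/\ 0 < c, lambda' = c * lambda & mu' = c * mu]
      & exists2 x, W x & h x = 0]
    /\
    [/\ W = zero_set h,
        W = [set x | lambda *: gradient f x + mu *: gradient g x = 0]
      & (forall x, W x -> 0 < mu * f x - lambda * g x) \/
        (forall x, W x -> mu * f x - lambda * g x < 0)].

Definition mutually_exclusive3 (P Q S : Prop) : Prop :=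
  [/\ ~ (P /\ Q), ~ (P /\ S) & ~ (Q /\ S)].

Definition exactly_one3 (P Q S : Prop) : Prop :=
  [\/ [/\ P, ~ Q & ~ S], [/\ ~ P, Q & ~ S] | [/\ ~ P, ~ Q & S]].

(* Main.v *)
(** Suppose that there is no common zero and no separation. Up to signs, [f > 0]
    on [{g = 0}] and [g > 0] on [{f = 0}], so [max(f, g)] never vanishes, and by
    the intermediate value theorem along segments it has a constant sign.
    If it is negative, [- f - g] is positive. If it is positive, Yuan's theorem of
    the alternative, applied to the homogenizations, gives a nonnegative nonzero
    combination [h = l f + m g]. When [h] has zeros, they form a convex set on
    which [m f - l g] does not vanish, hence has a constant sign; and a second
    nonnegative combination that is not proportional to [h] cannot vanish together
    with [h], so that their sum would be positive everywhere. *)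

From mathcomp Require Import ring lra.
Require Import Defs.

Import Order.TTheory.

Set Implicit Arguments.
Unset Strict Implicit.
Unset Printing Implicit Defensive.

Local Open Scope ring_scope.
Local Open Scope classical_set_scope.

(** * Intermediate values of parabolas on the unit interval *)

Lemma max_parabola_ivt (R : realType) (c0 c1 c2 d0 d1 d2 : R) :
  Num.max c0 d0 <= 0 <= Num.max (c0 + c1 + c2) (d0 + d1 + d2) ->
  exists2 t, 0 <= t <= 1 &
    Num.max (c0 + t * c1 + t ^+ 2 * c2) (d0 + t * d1 + t ^+ 2 * d2) = 0.
Proof.
move=> /andP[max0 max1].
(* Writing the parabolas as polynomials gives their continuity at once. *)
pose p (e0 e1 e2 : R) := e0%:P + 'X * e1%:P + 'X ^+ 2 * e2%:P.
have pE e0 e1 e2 t : (p e0 e1 e2).[t] = e0 + t * e1 + t ^+ 2 * e2.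
  by rewrite /p !hornerE.
pose m t := Num.max (p c0 c1 c2).[t] (p d0 d1 d2).[t].
have m0 : m 0 = Num.max c0 d0 by rewrite /m !pE; congr Num.max; ring.
have m1 : m 1 = Num.max (c0 + c1 + c2) (d0 + d1 + d2).
  by rewrite /m !pE; congr Num.max; ring.
have mcont : continuous m.
  by move=> t; apply: continuous_max; exact: continuous_horner.
have [||t t01 mt] := @IVT R m 0 1 0 ler01.
- exact: continuous_subspaceT.
- by rewrite m0 m1 ge_min le_max max0 max1 orbT.
- by exists t; rewrite -?pE //; move: t01; rewrite in_itv.
Qed.

Lemma parabola_ivt (R : realType) (c0 c1 c2 : R) :
  c0 <= 0 <= c0 + c1 + c2 ->
  exists2 t, 0 <= t <= 1 & c0 + t * c1 + t ^+ 2 * c2 = 0.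
Proof.
move=> c01; have [|t t01] := @max_parabola_ivt R c0 c1 c2 c0 c1 c2.
  by rewrite !maxxx.
by rewrite maxxx; exists t.
Qed.

(** A matrix-free notion of quadratic form, with [b] the mixed term. It applies directly to
    homogenizations, which live on the product ['cV[R]_n * R]. *)
Definition quadratic_on_planes (R : realType) (V : lmodType R) (p : V -> R) :=
  forall x y, exists b, forall s t,
    p (s *: x + t *: y) = s ^+ 2 * p x + s * t * b + t ^+ 2 * p y.

(** * Yuan's theorem of the alternative for two quadratic forms *)

Section YuanAlternative.
Variables (R : realType) (V : lmodType R) (p q : V -> R).
Hypotheses (pP : quadratic_on_planes p) (qP : quadratic_on_planes q).
Hypothesis pq_ge0 : forall x, 0 <= p x \/ 0 <= q x.

(* After replacing [y] by [- y] if need be, the mixed form is negative on the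
   whole segment from [x] to [y]; on that segment [p] and [q] agree somewhere,
   hence are both negative there. *)
Lemma mixed_form_ge0 x y t : 0 <= t <= 1 -> p x < 0 <= q x -> q y < 0 <= p y ->
  0 <= t * p x + (1 - t) * q x \/ 0 <= t * p y + (1 - t) * q y.
Proof.
move=> t01 px qy.
case: (lerP 0 (t * p x + (1 - t) * q x)) => [|rx]; first by left.
case: (lerP 0 (t * p y + (1 - t) * q y)) => [|ry]; first by right.
exfalso; have [bp bpE] := pP x y; have [bq bqE] := qP x y.
have [e e2 eb] : exists2 e : R, e ^+ 2 = 1 & e * (t * bp + (1 - t) * bq) <= 0.
  case: (lerP 0 (t * bp + (1 - t) * bq)) => b0.
    by exists (- 1); [ring|lra].
  by exists 1; [ring|lra].
(* These are the coefficients, in powers of [s], of [p - q] at [(1 - s) *: x + (s * e) *: y]; the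
   values at [s = 0] and [s = 1] have opposite signs. *)
have [|s s01 sE] := @parabola_ivt R (p x - q x)
  (- 2 * (p x - q x) + e * (bp - bq))
  ((p x - q x) - e * (bp - bq) + (p y - q y)); first by lra.
pose z := (1 - s) *: x + (s * e) *: y.
have pz : p z = (1 - s) ^+ 2 * p x + (1 - s) * s * (e * bp) + s ^+ 2 * p y.
  by rewrite bpE exprMn e2; ring.
have qz : q z = (1 - s) ^+ 2 * q x + (1 - s) * s * (e * bq) + s ^+ 2 * q y.
  by rewrite bqE exprMn e2; ring.
have pqz : p z = q z by apply/eqP; rewrite -subr_eq0 pz qz -sE; apply/eqP; ring.
have rz : p z = (1 - s) ^+ 2 * (t * p x + (1 - t) * q x)
    + (1 - s) * s * (e * (t * bp + (1 - t) * bq))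
    + s ^+ 2 * (t * p y + (1 - t) * q y).
  transitivity (t * p z + (1 - t) * q z); first by rewrite pqz; ring.
  by rewrite pz qz; ring.
have h1 : (1 - s) * s * (e * (t * bp + (1 - t) * bq)) <= 0.
  by apply: mulr_ge0_le0 => //; apply: mulr_ge0; lra.
have h2 : (1 - s) ^+ 2 * (t * p x + (1 - t) * q x)
    + s ^+ 2 * (t * p y + (1 - t) * q y) < 0.
  have h3 : s ^+ 2 * (t * p y + (1 - t) * q y) <= 0.
    by apply: mulr_ge0_le0; [exact: sqr_ge0|exact: ltW].
  have h4 : (1 - s) ^+ 2 * (t * p x + (1 - t) * q x) <= 0.
    by apply: mulr_ge0_le0; [exact: sqr_ge0|exact: ltW].
  case: (eqVneq s 1) => [s1|s1].
    by rewrite s1; lra.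
  suff : (1 - s) ^+ 2 * (t * p x + (1 - t) * q x) < 0 by lra.
  by rewrite nmulr_llt0 // exprn_even_gt0 //= subr_eq0 eq_sym.
have [] := pq_ge0 z; rewrite -?pqz rz; lra.
Qed.

(** A point with [q z < 0 <= p z] demands [rho z <= t], one with [p z < 0 <= q z] demands
    [t <= rho z]. By [mixed_form_ge0] no lower bound exceeds an upper bound, so the supremum of the
    lower bounds meets all demands. *)
Lemma yuan_alternative :
  exists2 t, 0 <= t <= 1 & forall x, 0 <= t * p x + (1 - t) * q x.
Proof.
(* [t * p z + (1 - t) * q z] vanishes at [t = rho z] *)
pose rho z := q z / (q z - p z).
(* Including [0] keeps [S] nonempty and its supremum nonnegative. *)
pose S := [set t | t = 0 \/ exists2 y, q y < 0 <= p y & t = rho y].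
have rho01 y : q y < 0 <= p y -> 0 <= rho y <= 1.
  move=> qy; have d0 : q y - p y < 0 by lra.
  by rewrite /rho ler_ndivlMr // ler_ndivrMr //; lra.
have S1 : ubound S 1 by move=> t [->|[y /rho01 /andP[_ ?] ->]].
have supS : has_ubound S by exists 1.
have S0 : S 0 by left.
have sup01 : 0 <= sup S <= 1.
  by rewrite (ub_le_sup supS) //= ge_sup //; exists 0.
exists (sup S) => // x; have [px|px] := lerP 0 (p x).
  have [qx|qx] := lerP 0 (q x).
    by apply: addr_ge0; apply: mulr_ge0; lra.
  have qpx : q x < 0 <= p x by rewrite qx.
  have : rho x <= sup S by apply: ub_le_sup => //; right; exists x.
  have d0 : q x - p x < 0 by lra.
  by rewrite ler_ndivrMr //; lra.
have qx : 0 <= q x by case: (pq_ge0 x); lra.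
have d0 : 0 < q x - p x by lra.
suff : sup S <= rho x by rewrite ler_pdivlMr //; lra.
apply: ge_sup => [|_ [->|[y qy ->]]]; first by exists 0.
  by apply: divr_ge0; lra.
rewrite leNgt; apply/negP => xy.
(* Strictly between the two bounds, the combination would be negative at both [x] and [y]. *)
pose t := (rho x + rho y) / 2.
have x0 : 0 <= rho x by apply: divr_ge0; lra.
have /andP[y0 y1] := rho01 y qy.
have e0 : q y - p y < 0 by lra.
have tx : rho x < t by rewrite /t; lra.
have ty : t < rho y by rewrite /t; lra.
have [||||] := @mixed_form_ge0 x y t; try lra.
  by move: tx; rewrite ltr_pdivrMr //; lra.
by move: ty; rewrite ltr_ndivlMr //; lra.
Qed.

End YuanAlternative.

(** * Quadratic functions: restriction to lines, gradient, homogenization *)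

Lemma quadratic_comb (R : realType) (n : nat) (A B : 'M[R]_n) (a b : 'cV[R]_n)
    (a0 b0 l m : R) x :
  l * quadratic A a a0 x + m * quadratic B b b0 x =
  quadratic (l *: A + m *: B) (l *: a + m *: b) (l * a0 + m * b0) x.
Proof.
rewrite /quadratic [(_ + _)^T]linearD /= ![(_ *: _)^T]linearZ /=.
rewrite !mulmxDr !mulmxDl.
rewrite -!scalemxAr -!scalemxAl
  ![fun_of_matrix (_ + _) _ _]mxE ![fun_of_matrix (_ *: _) _ _]mxE; ring.
Qed.

Lemma dotmxC (R : realType) (n : nat) (x y : 'cV[R]_n) :
  (x^T *m y) 0 0 = (y^T *m x) 0 0.
Proof.
have -> : y^T *m x = (x^T *m y)^T by rewrite trmx_mul trmxK.
by rewrite [RHS]mxE.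
Qed.

Section QuadraticFunction.
Variables (R : realType) (n : nat) (A : 'M[R]_n) (a : 'cV[R]_n) (a0 : R).

Lemma quadratic_line (symA : A^T = A) x s v :
  quadratic A a a0 (x + s *: v) = quadratic A a a0 x
    + s * (2 * ((A *m x + a)^T *m v) 0 0) + s ^+ 2 * (v^T *m A *m v) 0 0.
Proof.
have vAx : (v^T *m A *m x) 0 0 = (x^T *m A *m v) 0 0.
  by rewrite -mulmxA dotmxC trmx_mul symA.
rewrite /quadratic ![(_ + _)^T]linearD /= [(_ *: _)^T]linearZ /= trmx_mul symA
  !mulmxDr !mulmxDl.
by rewrite -!scalemxAr -!scalemxAl
  ![fun_of_matrix (_ + _) _ _]mxE ![fun_of_matrix (_ *: _) _ _]mxE vAx; ring.
Qed.

Lemma gradient_quadratic (symA : A^T = A) x :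
  gradient (quadratic A a a0) x = 2 *: (A *m x + a).
Proof.
apply/colP => i; rewrite [LHS]mxE [RHS]mxE; apply: cvg_lim => //.
set d := delta_mx i 0; pose c : R := (d^T *m A *m d) 0 0.
have -> : (A *m x + a) i 0 = ((A *m x + a)^T *m d) 0 0.
  by rewrite dotmxC trmx_delta -rowE [RHS]mxE.
set l := 2 * _.
(* For [s != 0] the difference quotient along [d] is the polynomial [l + c * s], so its limit is the
   value at [0]. *)
have -> : l = (l%:P + c *: 'X).[0] by rewrite !hornerE; ring.
have := @continuous_horner R (l%:P + c *: 'X) 0.
move/continuous_withinNx; apply: cvg_trans; apply: near_eq_cvg.
near=> s; have s0 : s != 0 by near: s; exact: nbhs_dnbhs_neq.
rewrite /= [s *: d + x]addrC quadratic_line // -/l -/c /GRing.scale hornerD hornerC hornerZ hornerX /=.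
by field.
Unshelve. all: by end_near.
Qed.

(** At [(x, s)] with [s != 0] this is [s ^+ 2] times the quadratic function at [s^-1 *: x]; at
    [s = 0] only the form of [A] remains. *)
Definition homogenization (z : 'cV[R]_n * R) : R :=
  (z.1^T *m A *m z.1) 0 0 + 2 * z.2 * (a^T *m z.1) 0 0 + a0 * z.2 ^+ 2.

Lemma homogenization_on_planes : quadratic_on_planes homogenization.
Proof.
move=> [x x'] [y y'].
exists ((x^T *m A *m y) 0 0 + (y^T *m A *m x) 0 0
  + 2 * x' * (a^T *m y) 0 0 + 2 * y' * (a^T *m x) 0 0 + 2 * a0 * x' * y').
move=> s t; rewrite /homogenization /= [(_ + _)^T]linearD /= ![(_ *: _)^T]linearZ /=.
rewrite !mulmxDr !mulmxDl -!scalemxAr -!scalemxAl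
  ![fun_of_matrix (_ + _) _ _]mxE ![fun_of_matrix (_ *: _) _ _]mxE /GRing.scale /=; ring.
Qed.

Lemma homogenization1 x : homogenization (x, 1) = quadratic A a a0 x.
Proof. by rewrite /homogenization /quadratic /=; ring. Qed.

Lemma homogenizationZ c z : homogenization (c *: z) = c ^+ 2 * homogenization z.
Proof.
have [b /(_ c 0)] := homogenization_on_planes z 0.
by rewrite scaler0 addr0 => ->; ring.
Qed.

End QuadraticFunction.

(** * Minimizers of a nonnegative quadratic function *)

Lemma parabola_lt0_pinfty (R : realType) (c0 c1 c2 : R) : c2 < 0 ->
  exists k0, forall k, k0 <= k -> c0 + k * c1 + k ^+ 2 * c2 < 0.
Proof.
(* Beyond this threshold [k >= 1] and [k * c2] outweighs the absolute values of [c1] and [c0]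
   together. *)
move=> c2_lt0; exists (1 + (`|c1| + `|c0|) / - c2) => k k_ge.
have kc : 0 <= (`|c1| + `|c0|) / - c2 by apply: divr_ge0; [exact: addr_ge0|lra].
have kc2 : k * c2 + (`|c1| + `|c0|) < 0.
  have : (`|c1| + `|c0|) / - c2 < k by lra.
  by rewrite ltr_pdivrMr; lra.
have k1 : 1 <= k by lra.
have h1 : k * (k * c2 + (`|c1| + `|c0|)) < 0 by rewrite pmulr_rlt0 //; lra.
have h2 : k * c1 <= k * `|c1| by rewrite ler_wpM2l ?ler_norm //; lra.
have h3 : c0 <= k * `|c0|.
  by rewrite (le_trans (ler_norm c0)) // ler_peMl.
by move: h1; rewrite mulrDr mulrDr mulrA -expr2; lra.
Qed.

(** Being bounded below forces [C] to be positive semidefinite, so a critical point is a minimizer.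
    Conversely, where the gradient is nonzero, a short step against it decreases the function. *)
Lemma argmin_gradient (R : realType) (n : nat) (C : 'M[R]_n) (c : 'cV[R]_n)
    (c0 : R) : C^T = C -> (forall x, 0 <= quadratic C c c0 x) ->
  argmin_set (quadratic C c c0) = [set x | gradient (quadratic C c c0) x = 0].
Proof.
move=> symC h_ge0; set h := quadratic C c c0.
have psd (v : 'cV[R]_n) : 0 <= (v^T *m C *m v) 0 0.
  rewrite leNgt; apply/negP => vv.
  have [k /(_ k (lexx k))] :=
    parabola_lt0_pinfty (h 0) (2 * ((C *m 0 + c)^T *m v) 0 0) vv.
  by rewrite /h -quadratic_line // ltNge h_ge0.
apply/seteqP; split=> x /=; rewrite gradient_quadratic //; last first.
  move=> /eqP; rewrite scaler_eq0 pnatr_eq0 /= => /eqP Cx0.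
  move=> y; have -> : y = x + 1 *: (y - x) by rewrite scale1r addrC subrK.
  rewrite /h quadratic_line // Cx0 trmx0 mul0mx mxE expr1n !mul1r mulr0 addr0.
  by rewrite lerDl.
move=> xmin; suff -> : C *m x + c = 0 by rewrite scaler0.
set d := C *m x + c; pose D : R := (d^T *m d) 0 0.
have DE : D = \sum_j d j 0 ^+ 2.
  by rewrite /D mxE; apply: eq_bigr => j _; rewrite mxE expr2.
have D_le0 : D <= 0.
  rewrite leNgt; apply/negP => D0.
  pose q : R := (d^T *m C *m d) 0 0; have q0 : 0 <= q := psd d.
  (* With this step length [r * q = D - r], so the increment [r * (r * q - 2 * D)] is negative;
     [q + 1] rather than [q] keeps the denominator positive. *)
  pose r := D / (q + 1); have q1 : 0 < q + 1 by lra.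
  have r0 : 0 < r by rewrite divr_gt0.
  have rq : r * (q + 1) = D by rewrite divfK ?gt_eqF.
  have := xmin (x + (- r) *: d).
  rewrite /h quadratic_line // -/d -/D -/q -addrA lerDl.
  have -> : - r * (2 * D) + (- r) ^+ 2 * q = r * (r * q - 2 * D) by ring.
  by rewrite pmulr_rge0 //; lra.
have D0 : D = 0.
  by apply/eqP; rewrite eq_le D_le0 DE sumr_ge0 // => j _; exact: sqr_ge0.
apply/colP => i; rewrite [RHS]mxE; apply/eqP; rewrite -sqrf_eq0 eq_le sqr_ge0 andbT.
rewrite -D0 DE (bigD1 i) //= lerDl sumr_ge0 // => j _; exact: sqr_ge0.
Qed.

(** * Nonnegative combinations of two quadratic functions *)

Lemma sum_sqr_neq0 (R : realType) (l m : R) :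
  (l, m) <> (0, 0) -> l ^+ 2 + m ^+ 2 != 0.
Proof.
move=> lm0; rewrite paddr_eq0 ?sqr_ge0 // !sqrf_eq0.
by apply/negP => /andP[/eqP l0 /eqP m0]; apply: lm0; rewrite l0 m0.
Qed.

(** The linear system in [u] and [v] has determinant [- (l ^+ 2 + m ^+ 2)]. *)
Lemma nonzero_pencil_cancel (R : realType) (l m u v : R) : (l, m) <> (0, 0) ->
  l * u + m * v = 0 -> m * u - l * v = 0 -> u = 0 /\ v = 0.
Proof.
move=> /sum_sqr_neq0 lm0 e1 e2; split; apply: (mulfI lm0); rewrite mulr0.
  transitivity (l * (l * u + m * v) + m * (m * u - l * v)); first by ring.
  by rewrite e1 e2; ring.
transitivity (m * (l * u + m * v) - l * (m * u - l * v)); first by ring.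
by rewrite e1 e2; ring.
Qed.

Section Pencil.
Variables (R : realType) (n : nat) (A B : 'M[R]_n) (a b : 'cV[R]_n) (a0 b0 : R).
Hypotheses (symA : A^T = A) (symB : B^T = B).
Let f := quadratic A a a0.
Let g := quadratic B b b0.

(** The alternative for forms is applied to the homogenizations. Its hypothesis at [(x, s)] follows
    by rescaling if [s != 0]; at [s = 0], two negative leading forms would make [f] and [g] both
    negative at a large multiple of [x]. *)
Lemma quadratic_alternative : (forall x, 0 <= f x \/ 0 <= g x) ->
  exists2 t, 0 <= t <= 1 & forall x, 0 <= t * f x + (1 - t) * g x.
Proof.
move=> fg_ge0.
have [||z|t t01 tP] := @yuan_alternative R _
    (homogenization A a a0) (homogenization B b b0).
- exact: homogenization_on_planes.
- exact: homogenization_on_planes.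
- case: (lerP 0 (homogenization A a a0 z)) => [|fz]; first by left.
  case: (lerP 0 (homogenization B b b0 z)) => [|gz]; first by right.
  exfalso; case: z fz gz => x s; have [->|s0] := eqVneq s 0.
    rewrite /homogenization /= !(mulr0, mul0r, expr0n, addr0) /= => fx gx.
    have [k fk] := parabola_lt0_pinfty a0 (2 * (a^T *m x) 0 0) fx.
    have [l gl] := parabola_lt0_pinfty b0 (2 * (b^T *m x) 0 0) gx.
    have quadE (C : 'M[R]_n) (c : 'cV[R]_n) c0 m : quadratic C c c0 (m *: x) =
        c0 + m * (2 * (c^T *m x) 0 0) + m ^+ 2 * (x^T *m C *m x) 0 0.
      rewrite -homogenization1 /homogenization /= [(_ *: _)^T]linearZ /=.
      rewrite -!scalemxAr -!scalemxAl ![fun_of_matrix (_ *: _) _ _]mxE; ring.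
    have := fg_ge0 (Num.max k l *: x); rewrite /f /g !quadE.
    have := fk (Num.max k l); have := gl (Num.max k l).
    by rewrite !le_max !lexx orbT => /(_ isT) ? /(_ isT) ? []; lra.
  have -> : (x, s) = s *: (s^-1 *: x, 1) :> 'cV[R]_n * R.
    by congr pair; rewrite /= ?scalerA ?divff // ?scale1r // /GRing.scale /= mulr1.
  rewrite !homogenizationZ !homogenization1.
  have s2 : 0 < s ^+ 2 by rewrite exprn_even_gt0.
  rewrite !pmulr_rlt0 // => fx gx.
  by case: (fg_ge0 (s^-1 *: x)); rewrite leNgt ?fx ?gx.
by exists t => // x; rewrite /f /g -!homogenization1.
Qed.

(** The sign hypotheses leave [max(f, g)] without zeros. If [f] and [g] are both negative somewhere,
    the maximum stays negative along every segment from there, and [- f - g] works; otherwise the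
    alternative applies. *)
Lemma semidefinite_pencil_of_signs :
  (forall x, g x = 0 -> 0 < f x) -> (forall x, f x = 0 -> 0 < g x) ->
  exists l m : R, (l, m) <> (0, 0) /\ forall x, 0 <= l * f x + m * g x.
Proof.
move=> f_gt0 g_gt0.
have [[x [fx gx]]|nfg] := pselect (exists x, f x < 0 /\ g x < 0).
  exists (-1), (-1); split=> [[]|y]; first by lra.
  have [fgy|fgy] := ltP (Num.max (f y) (g y)) 0.
    by move: fgy; rewrite gt_max => /andP[]; lra.
  have yE : y = x + 1 *: (y - x) by rewrite scale1r addrC subrK.
  move: fgy; rewrite {1 2}yE /f /g !quadratic_line // !(mul1r, expr1n) => fgy.
  have fgx : Num.max (f x) (g x) <= 0 by rewrite ge_max !ltW.
  have /max_parabola_ivt[t _] := introT andP (conj fgx fgy).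
  rewrite -!quadratic_line // -/f -/g; set w := x + _ => maxw.
  have [fw|fw] := leP (f w) (g w).
    have gw : g w = 0 by rewrite -maxw; apply/esym/max_idPr.
    by have := f_gt0 w gw; lra.
  have fw0 : f w = 0 by rewrite -maxw; apply/esym/max_idPl/ltW.
  by have := g_gt0 w fw0; lra.
have [x|t t01 tP] := quadratic_alternative.
  case: (lerP 0 (f x)) => [|fx]; first by left.
  case: (lerP 0 (g x)) => [|gx]; first by right.
  by case: nfg; exists x.
by exists t, (1 - t); split=> // -[]; lra.
Qed.

Lemma gradient_comb (l m : R) x :
  gradient (fun y => l * f y + m * g y) x = l *: gradient f x + m *: gradient g x.
Proof.
under [in LHS]eq_fun do rewrite quadratic_comb.
rewrite !gradient_quadratic //; last by rewrite linearD /= !linearZ /= symA symB.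
by rewrite mulmxDl -!scalemxAl !scalerDr !scalerA ![_ * 2]mulrC addrACA.
Qed.

Lemma pencil_of_semidefinite (l m : R) :
  zero_set f `&` zero_set g = set0 -> (l, m) <> (0, 0) ->
  (forall x, 0 <= l * f x + m * g x) ->
  positive_pencil f g \/ tangent_pencil f g.
Proof.
move=> fg0 lm0 h_ge0; set h := fun x => l * f x + m * g x.
have no_zero x : f x = 0 -> g x = 0 -> False.
  by move=> fx gx; have : (zero_set f `&` zero_set g) x by []; rewrite fg0.
have [c1|nc1] := pselect (positive_pencil f g); [by left|right].
have [x0 hx0] : exists x0, h x0 = 0.
  apply: contrapT => h0; apply: nc1; exists l, m; split=> // x.
  rewrite lt_neqAle h_ge0 andbT eq_sym; apply/eqP => hx; apply: h0; by exists x.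
pose k x := m * f x - l * g x.
have k0 x : h x = 0 -> k x <> 0.
  by move=> hx kx; have [] := nonzero_pencil_cancel lm0 hx kx; exact: no_zero.
have W0 : argmin_set h = zero_set h.
  apply/seteqP; split=> x /=; last by move=> hx y; rewrite hx; exact: h_ge0.
  by move=> /(_ x0); rewrite hx0 => hx; apply/eqP; rewrite eq_le hx; exact: h_ge0.
have symC : (l *: A + m *: B)^T = l *: A + m *: B.
  by rewrite linearD /= !linearZ /= symA symB.
have hE : h = quadratic (l *: A + m *: B) (l *: a + m *: b) (l * a0 + m * b0).
  by apply/funext => x; rewrite -quadratic_comb.
have kE : k = quadratic (m *: A + (- l) *: B) (m *: a + (- l) *: b)
    (m * a0 + (- l) * b0).
  by apply/funext => x; rewrite -quadratic_comb mulNr.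
have symD : (m *: A + (- l) *: B)^T = m *: A + (- l) *: B.
  by rewrite linearD /= !linearZ /= symA symB.
(* A sign change of [k] between two zeros of [h] would give a zero of [k] on the segment joining
   them, where [h] vanishes too. *)
have k_sign : (forall x, h x = 0 -> 0 < k x) \/ (forall x, h x = 0 -> k x < 0).
  apply: contrapT => /not_orP[/existsNP[x /not_implyP[hx kx]]].
  move=> /existsNP[y /not_implyP[hy ky]].
  have yE : y = x + 1 *: (y - x) by rewrite scale1r addrC subrK.
  have {}kx : k x <= 0 by rewrite leNgt; apply/negP.
  have {}ky : 0 <= k y by rewrite leNgt; apply/negP.
  have [|t /andP[t0 t1] kt] := @parabola_ivt R (k x)
      (2 * (((m *: A + (- l) *: B) *m x + (m *: a + (- l) *: b))^T *m (y - x)) 0 0)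
      (((y - x)^T *m (m *: A + (- l) *: B) *m (y - x)) 0 0).
    move: ky; rewrite {1}yE kE quadratic_line // -kE expr1n !mul1r => ky.
    by rewrite kx.
  apply: (k0 (x + t *: (y - x))); last by rewrite kE quadratic_line // -kE.
  have := h_ge0 (x + t *: (y - x)); rewrite -/(h _) => ht.
  apply/eqP; rewrite eq_le ht andbT; move: hy.
  rewrite {1}yE hE !quadratic_line // -hE hx expr1n !mul1r !add0r.
  set u := 2 * _; set v := ((y - x)^T *m _ *m _) 0 0 => uv.
  have -> : u = - v by lra.
  (* Evaluate [h] past [y], at parameter [2]: the value is [2 * u + 4 * v = 2 * v]. *)
  have v0 : 0 <= v.
    have := h_ge0 (x + 2 *: (y - x)); rewrite -/(h _) hE quadratic_line //.
    by rewrite -hE hx -/u -/v; lra.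
  have -> : t * - v + t ^+ 2 * v = - (v * (t * (1 - t))) by ring.
  by rewrite oppr_le0 !mulr_ge0 // subr_ge0.
exists l, m; split; split=> //.
- move=> l' m' lm'0 h'_ge0.
  have [z [hz h'z]] : exists z, h z = 0 /\ l' * f z + m' * g z = 0.
    apply: contrapT => /forallNP nz; apply: nc1.
    exists (l + l'), (m + m').
    have sum_gt0 x : 0 < (l + l') * f x + (m + m') * g x.
      have -> : (l + l') * f x + (m + m') * g x = h x + (l' * f x + m' * g x).
        by rewrite /h; ring.
      have [hx h'x] := (h_ge0 x, h'_ge0 x); rewrite -/(h x) in hx.
      rewrite lt_neqAle eq_sym paddr_eq0 // addr_ge0 // andbT.
      by apply/negP => /andP[/eqP ? /eqP ?]; apply: (nz x).
    split=> // -[l0 m0]; have := sum_gt0 0.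
    by rewrite l0 m0 !mul0r addr0 ltxx.
  (* Both coefficient pairs are orthogonal to the nonzero vector [(f z, g z)], hence parallel. *)
  have det0 : l * m' - m * l' = 0.
    have fgz : f z != 0 \/ g z != 0.
      have [fz|] := eqVneq (f z) 0; last by left.
      by right; apply/eqP => gz; exact: (no_zero z).
    case: fgz => z0; apply: (mulIf z0); rewrite mul0r.
      transitivity (m' * h z - m * (l' * f z + m' * g z)).
        by rewrite /h; ring.
      by rewrite hz h'z; ring.
    transitivity (l * (l' * f z + m' * g z) - l' * h z); first by rewrite /h; ring.
    by rewrite hz h'z; ring.
  (* [c] is the coefficient of the orthogonal projection of [(l', m')] onto [(l, m)]. *)
  pose N := l ^+ 2 + m ^+ 2; pose c := (l * l' + m * m') / N.
  have N0 : N != 0 by exact: sum_sqr_neq0.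
  have l'E : l' = c * l.
    apply: (mulIf N0); rewrite /c mulrAC divfK //.
    transitivity ((l * l' + m * m') * l - m * (l * m' - m * l')).
      by rewrite /N; ring.
    by rewrite det0; ring.
  have m'E : m' = c * m.
    apply: (mulIf N0); rewrite /c mulrAC divfK //.
    transitivity ((l * l' + m * m') * m + l * (l * m' - m * l')).
      by rewrite /N; ring.
    by rewrite det0; ring.
  (* If [c < 0], then [h] and [- h] are both nonnegative, so [h] is identically zero; [k] then has a
     constant sign on the whole space, and [k] or [- k] is a positive combination. *)
  exists c; split=> //; rewrite ltNge; apply/negP => c_le0.
  have c_lt0 : c < 0.
    rewrite lt_neqAle c_le0 andbT; apply/eqP => c0.
    by apply: lm'0; rewrite l'E m'E c0 !mul0r.
  have h0 x : h x = 0.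
    apply/eqP; rewrite eq_le h_ge0 andbT -(nmulr_rge0 _ c_lt0).
    have -> : c * h x = l' * f x + m' * g x by rewrite l'E m'E /h; ring.
    exact: h'_ge0.
  case: k_sign => k_sign; apply: nc1.
    exists m, (- l); split=> [[m0 l0]|x]; last by rewrite mulNr; exact: k_sign.
    by apply: lm0; congr pair; lra.
  exists (- m), l; split=> [[m0 l0]|x].
    by apply: lm0; congr pair; lra.
  by rewrite mulNr addrC -opprB oppr_gt0; exact: k_sign.
- by exists x0; rewrite // W0.
- rewrite -[argmin_set _]/(argmin_set h) hE argmin_gradient -?hE //.
  by apply/seteqP; split=> x /=; rewrite -gradient_comb.
- by rewrite W0.
Qed.

End Pencil.

(** * Mutual exclusion, and signs in the absence of separation *)

Section Separation.
Variables (R : realType) (n : nat) (f g : 'cV[R]_n -> R).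

(** By uniqueness the positive combination is a multiple of the tangent one, which has a zero. *)
Lemma positive_tangent_pencil_false :
  positive_pencil f g -> tangent_pencil f g -> False.
Proof.
move=> [l' [m' [lm' pos]]] [l [m [[_ _ uniq [x _ hx]] _]]].
have [c [_ l'E m'E]] := uniq l' m' lm' (fun x => ltW (pos x)).
have := pos x; rewrite l'E m'E -!mulrA -mulrDr => ch.
by move: ch; rewrite hx mulr0 ltxx.
Qed.

(* A nonnegative combination cannot weight a function that takes both signs
   where the other one vanishes. *)
Lemma separation_nonneg_pencil (l m : R) : separation_property f g ->
  (forall x, 0 <= l * f x + m * g x) ->
  exists u v, [/\ l * f u + m * g u = 0, l * f v + m * g v = 0
                & (m * f u - l * g u) * (m * f v - l * g v) <= 0].
Proof.
have scale_eq0 (c r s : R) : r < 0 -> 0 < s -> 0 <= c * r -> 0 <= c * s -> c = 0.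
  move=> r0 s0; rewrite nmulr_lge0 // pmulr_lge0 // => c_le0 c_ge0.
  by apply/eqP; rewrite eq_le c_le0.
have sign (c r s : R) : r < 0 -> 0 < s -> (c * r) * (c * s) <= 0.
  by move=> r0 s0; rewrite mulrACA mulr_ge0_le0 -?expr2 ?sqr_ge0 // mulr_le0_ge0 // ltW.
case=> -[Lm [Lp [[u Lu] [v Lv] LE]]] /(_ u v Lu Lv)[u0 v0] h_ge0; exists u, v.
  have gu : g u = 0 by have : zero_set g u by rewrite -LE; left.
  have gv : g v = 0 by have : zero_set g v by rewrite -LE; right.
  have := h_ge0 v; have := h_ge0 u; rewrite gu gv !mulr0 !addr0 !subr0 => hu hv.
  by rewrite (scale_eq0 _ _ _ u0 v0 hu hv) !mul0r; split=> //; exact: sign.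
have fu : f u = 0 by have : zero_set f u by rewrite -LE; left.
have fv : f v = 0 by have : zero_set f v by rewrite -LE; right.
have := h_ge0 v; have := h_ge0 u; rewrite fu fv !mulr0 !add0r => hu hv.
rewrite (scale_eq0 _ _ _ u0 v0 hu hv) !mul0r; split=> //.
by rewrite mulrNN; exact: sign.
Qed.

Lemma positive_pencil_separation_false :
  positive_pencil f g -> separation_property f g -> False.
Proof.
move=> [l [m [_ pos]]] /separation_nonneg_pencil.
move=> /(_ l m (fun x => ltW (pos x)))[u [_ [hu _ _]]].
by have := pos u; rewrite hu ltxx.
Qed.

(** Separation yields two minimizers at which [m * f - l * g] does not have the same strict sign. *)
Lemma tangent_pencil_separation_false :
  tangent_pencil f g -> separation_property f g -> False.
Proof.
move=> [l [m [[_ h_ge0 _ _] [W0 _ kW]]]] /separation_nonneg_pencil.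
move=> /(_ l m h_ge0)[u [v [hu hv]]]; apply/negP; rewrite -ltNge.
by case: kW => kW; [apply: mulr_gt0|rewrite nmulr_rgt0]; apply: kW; rewrite W0.
Qed.

(** If [f] took both signs on [S], the parts of [S] where it is negative and positive would witness
    separation. The sign is encoded as a scalar [e] so that [f] can be rescaled by it. *)
Lemma not_separates_sign (S : set 'cV[R]_n) :
  (forall x, S x -> f x <> 0) -> ~ separates f S ->
  exists2 e : R, e ^+ 2 = 1 & forall x, S x -> 0 < e * f x.
Proof.
move=> fS nsep.
have [[u [Su fu]]|pos] := pselect (exists u, S u /\ f u < 0); last first.
  exists 1 => [|x Sx]; first exact: expr1n.
  rewrite mul1r ltNge; apply/negP; rewrite le_eqVlt => /predU1P[/fS|fx].
    exact.
  by apply: pos; exists x.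
exists (- 1) => [|x Sx]; first by rewrite sqrrN expr1n.
rewrite mulN1r oppr_gt0 ltNge; apply/negP; rewrite le_eqVlt => /predU1P[fx0|fx].
  by apply: (fS x).
apply: nsep; exists (S `&` [set x | f x < 0]), (S `&` [set x | 0 < f x]).
split; [by exists u|by exists x| |by move=> ? ? [_ ?] [_ ?]].
rewrite -setIUr; apply/seteqP; split=> [y []//|y Sy]; split=> //=.
by have /eqP := fS y Sy; rewrite neq_lt => /orP.
Qed.

End Separation.

(** * The trichotomy for disjoint zero sets *)

Theorem theorem5 (R : realType) (n : nat) (A B : 'M[R]_n) (a b : 'cV[R]_n)
    (a0 b0 : R) (symA : A^T = A) (symB : B^T = B) :
  let f := quadratic A a a0 in
  let g := quadratic B b b0 in
  let C1 := positive_pencil f g in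
  let C2 := tangent_pencil f g in
  let C3 := separation_property f g in
  mutually_exclusive3 C1 C2 C3 /\
  (zero_set f `&` zero_set g = set0 <-> exactly_one3 C1 C2 C3).
Proof.
move=> f g C1 C2 C3.
have n12 : ~ (C1 /\ C2) by move=> [/positive_tangent_pencil_false].
have n13 : ~ (C1 /\ C3) by move=> [/positive_pencil_separation_false].
have n23 : ~ (C2 /\ C3) by move=> [/tangent_pencil_separation_false].
split=> //; split=> [fg0|c123]; last first.
  rewrite -subset0 => x [/= fx gx].
  (* Each of the three statements fails at a common zero. *)
  case: c123 => [[[l [m [_ pos]]] _ _]|[_ c2 _]|[_ _ c3]].
  - by have := pos x; rewrite fx gx !mulr0 addr0 ltxx.
  - case: c2 => l [m [_ [W0 _ kW]]].
    have Wx : argmin_set (fun x => l * f x + m * g x) x.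
      by rewrite W0 /zero_set /= fx gx !mulr0 addr0.
    by case: kW => /(_ x Wx); rewrite fx gx !mulr0 subr0 ltxx.
  - case: c3 => -[Lm [Lp [[u Lu] [v Lv] LE]]] sgn.
      have : (Lm `|` Lp) x by rewrite LE.
      by case=> Lx; [have [+ _] := sgn x v Lx Lv|have [_] := sgn u x Lu Lx];
        rewrite fx ltxx.
    have : (Lm `|` Lp) x by rewrite LE.
    by case=> Lx; [have [+ _] := sgn x v Lx Lv|have [_] := sgn u x Lu Lx];
      rewrite gx ltxx.
have [c3|nc3] := pselect C3.
  by apply: Or33; split=> // ?; [apply: n13|apply: n23].
have no_zero x : f x = 0 -> g x = 0 -> False.
  by move=> fx gx; have : (zero_set f `&` zero_set g) x by []; rewrite fg0.
have [e e2 f_sign] : exists2 e : R, e ^+ 2 = 1 & forall x, g x = 0 -> 0 < e * f x.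
  apply: (@not_separates_sign _ _ f (zero_set g)) => [x gx fx|sep].
    exact: (no_zero x).
  by apply: nc3; left.
have [d d2 g_sign] : exists2 d : R, d ^+ 2 = 1 & forall x, f x = 0 -> 0 < d * g x.
  apply: (@not_separates_sign _ _ g (zero_set f)) => [x fx gx|sep].
    exact: (no_zero x).
  by apply: nc3; right.
have scaleE (C : 'M[R]_n) c c0 r x : 
    r * quadratic C c c0 x = quadratic (r *: C) (r *: c) (r * c0) x.
  have := quadratic_comb C C c c c0 c0 r 0 x.
  by rewrite !mul0r !scale0r !addr0.
have unit_neq0 (r : R) : r ^+ 2 = 1 -> r != 0.
  by move=> r2; rewrite -sqrf_eq0 r2 oner_eq0.
have scale_sym (C : 'M[R]_n) (r : R) : C^T = C -> (r *: C)^T = r *: C.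
  by move=> symC; rewrite linearZ /= symC.
(* The signs are normalized by passing to [e * f] and [d * g]; a combination of these with weights
   [l], [m] is one of [f], [g] with weights [l * e], [m * d]. *)
have [|x|l [m [lm0 lm_ge0]]] := @semidefinite_pencil_of_signs R n (e *: A) (d *: B)
    (e *: a) (d *: b) (e * a0) (d * b0) (scale_sym _ _ symA) (scale_sym _ _ symB).
- move=> x; rewrite -!scaleE => /eqP; rewrite mulf_eq0 (negPf (unit_neq0 _ d2)).
  by move/eqP; exact: f_sign.
- rewrite -!scaleE => /eqP; rewrite mulf_eq0 (negPf (unit_neq0 _ e2)).
  by move/eqP; exact: g_sign.
have [|x|c1|c2] := @pencil_of_semidefinite R n A B a b a0 b0 symA symB
    (l * e) (m * d) fg0.
- move=> -[/eqP + /eqP]; rewrite !mulf_eq0 (negPf (unit_neq0 _ e2)).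
  rewrite (negPf (unit_neq0 _ d2)) !orbF => /eqP l0 /eqP m0.
  by apply: lm0; rewrite l0 m0.
- by have := lm_ge0 x; rewrite -!scaleE !mulrA.
- by apply: Or31; split=> // ?; apply: n12.
- by apply: Or32; split=> // ?; apply: n12.
Qed.
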